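(* For every integer $d\ge 0$, $$E_d = \sum_{\delta\in \mathrm{PCom}_{\mathrm{dyad}}(d)} (-1)^{\ell(\delta)}E_\delta^+.$$
   Context: A composition of $n\ge 0$ is a finite tuple of positive integers with sum $n$; its length $\ell$ is the number of entries; the empty composition is the only composition of $0$. A polycomposition of $n$ is a sequence $\delta=(\alpha^{(1)},\alpha^{(2)},\dots)$ of (possibly empty) compositions with $\sum_{i\ge1} i|\alpha^{(i)}|=n$, where $|\alpha|$ is the sum of the entries of $\alpha$; write $\delta|^i=\alpha^{(i)}$ and $\ell(\delta)=\sum_i\ell(\delta|^i)$. Each part $d$ of $\delta|^r$ gives a block $d^r$ of $\delta$ (degree $d$, multiplicity $r$; not exponentiation). $\mathrm{PCom}_{\mathrm{dyad}}(d)$ is the set of dyadic polycompositions of $d$: those in which all multiplicities are powers of $2$, i.e. $\delta|^i$ is empty unless $i=2^k$ for some $k\ge 0$. Let $x_{i,j}$ ($i,j\ge 1$) be indeterminates with $\deg x_{i,j}=i$; all series have rational coefficients. A monomial is square-free if every exponent is at most $1$. For $d\ge 0$, $E^+_d$ is the sum of all square-free monomials of degree $d$, and $E_d$ is the sum over square-free monomials $f$ of degree $d$ of $(-1)^{m(f)}f$, where $m(f)$ is the number of indeterminates in $f$. For a block $d^r$, $E^+_{d^r}$ is obtained from $E^+_d$ by replacing each $x_{i,j}$ by $x_{i,j}^r$, and $E^+_\delta=\prod E^+_{d^r}$ over all blocks $d^r$ of $\delta$ (counted with repetition; empty product $=1$). *)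

(* Defs.v *)
From HB Require Import structures.
From mathcomp Require Import all_boot all_order all_algebra finmap.
From mathcomp Require Import monalg.
From mathcomp Require Import boolp classical_sets functions cardinality fsbigop.

Set Implicit Arguments.
Unset Strict Implicit.
Unset Printing Implicit Defensive.

Import Order.TTheory GRing.Theory Num.Theory.

Local Open Scope classical_set_scope.
Local Open Scope ring_scope.

Notation posnat := {n : nat | (0 < n)%N}.

(* The pair (i, j) is the indeterminate x_{i,j}. *)
Notation indet := (posnat * posnat)%type.

Notation monom := {cmonom indet}.

Notation "1" := (@mone _) : monom_scope.
Notation "x * y" := (mmul x y) : monom_scope.

Lemma inj_finite_set (T : Type) (F : finType) (A : set T) (f : T -> F) :
  {in A &, injective f} -> finite_set A.
Proof.
move=> injf; have /card_eqPle[_ le] := inj_card_eq injf.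
exact: (card_le_finite le finite_finset).
Qed.

Lemma finite_divisors (m : monom) :
  finite_set [set a : monom | exists b : monom, (a * b)%M = m].
Proof.
pose f (a : monom) : {ffun finsupp m -> 'I_(mdeg m).+1} :=
  [ffun v => inord (a (val v))].
have le (a : monom) v : (exists b, (a * b)%M = m) -> (a v <= m v)%N.
  by case=> b <-; rewrite cmM leq_addr.
have le_deg v : (m v <= mdeg m)%N.
  rewrite mdegE; case: (mdomP m v) => // vm.
  by rewrite (big_fsetD1 v) //= leq_addr.
apply: (@inj_finite_set _ _ _ f) => a b /set_mem aD /set_mem bD /ffunP ab.
apply/eqP/cmP => v; case: (boolP (v \in finsupp m)) => [vm|].
  have := ab [` vm]%fset; rewrite !ffunE => /(congr1 val) /=.
  rewrite !inordK // ltnS; first exact: leq_trans (le _ v bD) (le_deg v).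
  exact: leq_trans (le _ v aD) (le_deg v).
rewrite -cmE_eq0 => /eqP mv0.
have := le _ v aD; have := le _ v bD.
by rewrite mv0 !leqn0 => /eqP -> /eqP ->.
Qed.

(* Formal power series with rational coefficients: a series is its function of
   coefficients, so infinite sums of distinct monomials are allowed. The alias
   keeps the pointwise product of functions from being picked as the ring
   product. *)
Definition series := monom -> rat.

HB.instance Definition _ := GRing.Zmodule.copy series (monom -> rat).

Section SeriesRing.
Implicit Types (f g h : series) (m : monom).

Definition series_one : series := fun m => (m == 1%M)%:R.

(* The index set is finite, see finite_factorisations. *)
Definition series_mul f g : series := fun m =>
  \sum_(p \in [set p : monom * monom | (p.1 * p.2)%M = m]) (f p.1 * g p.2).

Lemma finite_factorisations m :
  finite_set [set p : monom * monom | (p.1 * p.2)%M = m].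
Proof.
apply: sub_finite_set (finite_setX (finite_divisors m) (finite_divisors m)).
move=> [a b] /= abm; split => /=; first by exists b.
by exists a; rewrite mulmC.
Qed.

Lemma mem_divisors m (a : monom) :
  reflect (exists b : monom, (a * b)%M = m)
    (a \in fset_set [set a : monom | exists b : monom, (a * b)%M = m]).
Proof.
rewrite in_fset_set; last exact: finite_divisors.
by apply: (iffP idP) => [/set_mem | /mem_set].
Qed.

Lemma series_mulE f g m (D : {fset monom}) :
  (forall a b : monom, (a * b)%M = m -> (a \in D) && (b \in D)) ->
  series_mul f g m =
  \sum_(a <- D) \sum_(b <- D) if (a * b)%M == m then f a * g b else 0.
Proof.
move=> mD; rewrite /series_mul.
rewrite fsbig_finite; last exact: finite_factorisations.
rewrite -(@big_allpairs _ _ _ _ _ _ _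
  (fun p : monom * monom => if (p.1 * p.2)%M == m then f p.1 * g p.2 else 0)).
rewrite -[RHS]big_mkcond -[RHS]big_filter; apply: perm_big.
apply: uniq_perm; first exact: fset_uniq.
  by rewrite filter_uniq // allpairs_uniq ?fset_uniq // => -[? ?] [? ?].
move=> [a b]; rewrite in_fset_set; last exact: finite_factorisations.
rewrite mem_filter /=; apply/idP/andP => [/set_mem /= abm | [/eqP abm _]].
  rewrite abm eqxx; split=> //; apply/allpairsP; exists (a, b).
  by have /andP[] := mD _ _ abm.
exact/mem_set.
Qed.

Lemma series_mul3E f g h m (D : {fset monom}) :
  D = fset_set [set a : monom | exists b : monom, (a * b)%M = m] ->
  series_mul f (series_mul g h) m =
  \sum_(a <- D) \sum_(b <- D) \sum_(c <- D)
    if (a * (b * c))%M == m then f a * (g b * h c) else 0.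
Proof.
move=> DE.
have inD (a b : monom) : (a * b)%M = m -> (a \in D) && (b \in D).
  move=> abm; rewrite DE; apply/andP; split; apply/mem_divisors.
    by exists b.
  by exists a; rewrite mulmC.
rewrite (@series_mulE _ _ _ D) //; apply: eq_big_seq => a aD.
transitivity (\sum_(d <- D) \sum_(b <- D) \sum_(c <- D)
    if (b * c)%M == d then
      if (a * d)%M == m then f a * (g b * h c) else 0 else 0).
  apply: eq_big_seq => d; rewrite DE => /mem_divisors[e dem].
  case: eqP => adm; last first.
    by rewrite big1 // => b _; rewrite big1 // => c _; rewrite if_same.
  rewrite (@series_mulE _ _ d D); last first.
    move=> b c bcd; have /andP[-> _] : (b \in D) && ((c * e)%M \in D).
      by apply: inD; rewrite mulmA bcd.
    by have /andP[->] : (c \in D) && ((b * e)%M \in D); first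
      by apply: inD; rewrite mulmA (mulmC c) bcd.
  rewrite -DE mulr_sumr; apply: eq_bigr => b _; rewrite mulr_sumr.
  by apply: eq_bigr => c _; case: ifP; rewrite ?mulr0.
rewrite exchange_big /=; apply: eq_bigr => b _.
rewrite exchange_big /=; apply: eq_bigr => c _.
case: eqP => [abcm | nabcm]; last first.
  by rewrite big1 // => d _; case: eqP => // <-; case: eqP.
have /andP[_ bcD] := inD _ _ abcm.
rewrite (bigD1_seq (b * c)%M) ?fset_uniq //= eqxx abcm eqxx.
by rewrite big1 ?addr0 // => d /negPf; rewrite eq_sym => ->.
Qed.

Lemma series_mulC : commutative series_mul.
Proof.
move=> f g; apply/funext => m; rewrite /series_mul.
rewrite (@reindex_fsbig _ _ _ _ _ (fun p : monom * monom => (p.2, p.1))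
  [set p | (p.1 * p.2)%M = m]) /=.
  by apply: eq_fsbigr => p _; rewrite mulrC.
split=> [[a b] /= <-|[a b] [c d] _ _ /= [-> ->] //|[a b] /= abm].
  by rewrite mulmC.
by exists (b, a); rewrite //= mulmC.
Qed.

Lemma series_mulA : associative series_mul.
Proof.
move=> f g h; rewrite [RHS]series_mulC (series_mulC f g).
apply/funext => m; rewrite !(series_mul3E _ _ _ erefl).
set D := fset_set _.
rewrite [RHS]exchange_big [LHS](eq_bigr _ (fun a _ => exchange_big _ _ _ _ _ _)).
rewrite [LHS]exchange_big.
rewrite [LHS](eq_bigr _ (fun c _ => exchange_big _ _ _ _ _ _)).
rewrite [RHS]exchange_big; apply: eq_bigr => c _; apply: eq_bigr => b _ /=.
apply: eq_bigr => a _.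
have -> : (a * (b * c) = c * (b * a))%M by rewrite mulmC (mulmC b) -mulmA.
by rewrite mulrC (mulrC (g b)) -mulrA.
Qed.

Lemma series_mul1 : left_id series_one series_mul.
Proof.
move=> f; apply/funext => m; rewrite /series_mul.
rewrite -(@fsbig_widen _ _ _ _ [set ((1 : monom)%M, m)]
  [set p | (p.1 * p.2)%M = m]) /=.
- by rewrite fsbig_set1 /series_one eqxx mul1r.
- by move=> _ ->; rewrite /= mul1m.
move=> [a b] /= [abm nab]; rewrite /series_one; case: eqP => [a1|_].
  by case: nab; rewrite -abm a1 mul1m.
by rewrite mul0r.
Qed.

Lemma series_mulDl : left_distributive series_mul +%R.
Proof.
move=> f g h; apply/funext => m; rewrite /series_mul.
rewrite -[RHS]fsbig_split; last exact: finite_factorisations.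
by apply: eq_fsbigr => p _; rewrite mulrDl.
Qed.

Lemma series_one_neq0 : series_one != 0.
Proof.
by apply/eqP => /(congr1 (fun f : series => f 1%M)); rewrite /series_one eqxx.
Qed.

End SeriesRing.

HB.instance Definition _ := GRing.Zmodule_isComNzRing.Build series
  series_mulA series_mulC series_mul1 series_mulDl series_one_neq0.

Definition deg (m : monom) : nat := (\sum_(x <- finsupp m) m x * val x.1)%N.

Definition squarefree (m : monom) : bool :=
  all (fun x => m x <= 1)%N (finsupp m).

Definition E (d : nat) : series := fun m =>
  if squarefree m && (deg m == d) then (-1) ^+ #|` finsupp m| else 0.

Definition Eplus (d : nat) : series := fun m =>
  if squarefree m && (deg m == d) then 1 else 0.

(* Substitution of x_{i,j}^r for every x_{i,j}; for r > 0 the sum has at most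
   one term, since a monomial has at most one r-th root. *)
Definition subst_pow (r : nat) (f : series) : series := fun m =>
  \sum_(a \in [set a : monom | expcmn a r = m]) f a.

(* The finite support encodes that a polycomposition of n has only finitely
   many nonempty components, which the weight condition forces anyway. *)
Notation polycomp := {fsfun posnat -> seq posnat with [::]}.

Definition weight (delta : polycomp) : nat :=
  (\sum_(i <- finsupp delta) val i * \sum_(d <- delta i) val d)%N.

Definition plength (delta : polycomp) : nat :=
  (\sum_(i <- finsupp delta) size (delta i))%N.

(* The pair (d, r) is the block of degree d and multiplicity r. *)
Definition blocks (delta : polycomp) : seq (posnat * posnat) :=
  [seq (d, r) | r <- finsupp delta, d <- delta r].

Definition PCom (n : nat) : set polycomp := [set delta | weight delta = n].

Definition PCom_dyad (n : nat) : set polycomp :=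
  [set delta | PCom n delta /\
    forall i, delta i != [::] -> exists k : nat, val i = (2 ^ k)%N].

Definition Eplus_block (b : posnat * posnat) : series :=
  subst_pow (val b.2) (Eplus (val b.1)).

Definition Eplus_poly (delta : polycomp) : series :=
  \prod_(b <- blocks delta) Eplus_block b.

Lemma finite_PCom n : finite_set (PCom n).
Proof.
pose f (delta : polycomp) : {ffun 'I_n.+1 -> {ffun 'I_n.+1 -> 'I_n.+1}} :=
  [ffun i : 'I_n.+1 => [ffun j : 'I_n.+1 =>
    if insub (val i) is Some i' then inord (nth 0 (map val (delta i')) j)
    else ord0]].
have sum_ge (s : seq posnat) : (size s <= \sum_(d <- s) val d)%N.
  elim: s => [|d s IHs]; first by rewrite big_nil.
  by rewrite big_cons /= -add1n leq_add // (valP d).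
have nth_le (s : seq posnat) j : (nth 0 (map val s) j <= \sum_(d <- s) val d)%N.
  elim: s j => [|d s IHs] [|j] //=; rewrite big_cons ?leq_addr //.
  exact: leq_trans (IHs j) (leq_addl _ _).
have le_n delta i : PCom n delta -> i \in finsupp delta ->
    (val i <= n)%N /\ (\sum_(d <- delta i) val d <= n)%N.
  move=> <- iS; rewrite /weight (big_fsetD1 i) //=.
  set s := (\sum_(d <- delta i) val d)%N.
  have s_gt0 : (0 < s)%N.
    apply: leq_trans (sum_ge _); rewrite lt0n size_eq0.
    by move: iS; rewrite mem_finsupp.
  split; apply: leq_trans (leq_addr _ _); first by rewrite leq_pmulr.
  by rewrite leq_pmull // (valP i).
apply: (@inj_finite_set _ _ _ f) => delta1 delta2.
move=> /set_mem H1 /set_mem H2 /ffunP eqf; apply/fsfunP => i.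
have le2 delta : PCom n delta -> (\sum_(d <- delta i) val d <= n)%N.
  move=> Hd; case: (boolP (i \in finsupp delta)) => [/(le_n _ _ Hd)[]//|iS].
  by rewrite fsfun_dflt // big_nil.
case: (leqP (val i) n) => [i_n|n_i]; last first.
  have out delta : PCom n delta -> delta i = [::].
    move=> Hd; apply: fsfun_dflt; apply/negP => /(le_n _ _ Hd)[].
    by rewrite leqNgt n_i.
  by rewrite !out.
have eqn j : (j <= n)%N ->
    nth 0 (map val (delta1 i)) j = nth 0 (map val (delta2 i)) j.
  move=> jn; have := eqf (Ordinal (i_n : (val i < n.+1)%N)).
  rewrite !ffunE => /ffunP/(_ (Ordinal (jn : (j < n.+1)%N))).
  rewrite !ffunE /= valK => /(congr1 val) /=.
  by rewrite !inordK // ltnS; apply: leq_trans (nth_le _ _) (le2 _ _).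
have sz delta : PCom n delta -> (size (delta i) <= n)%N.
  by move=> Hd; apply: leq_trans (sum_ge _) (le2 _ Hd).
have pos (s : seq posnat) j : (0 < nth 0 (map val s) j)%N = (j < size s)%N.
  case: (ltnP j (size s)) => js; last by rewrite nth_default ?size_map.
  case: s js => // d s js; rewrite (nth_map d) //.
  exact: (valP (nth d (d :: s) j)).
have eqs : size (delta1 i) = size (delta2 i).
  apply/eqP; rewrite eqn_leq; apply/andP; split; rewrite leqNgt.
    by rewrite -pos eqn ?sz // pos ltnn.
  by rewrite -pos -eqn ?sz // pos ltnn.
apply: (inj_map val_inj); apply: (@eq_from_nth _ 0%N); rewrite ?size_map //.
by move=> j js; apply: eqn; apply: leq_trans (ltnW js) (sz _ H1).
Qed.

Lemma finite_PCom_dyad n : finite_set (PCom_dyad n).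
Proof. by apply: sub_finite_set (finite_PCom n) => delta []. Qed.

(* Main.v *)
(* Let A_d be the right-hand side. Splitting off the first part of delta|^1 (if
   there is one), or halving all multiplicities (if delta|^1 is empty), gives
     A_d = [d even] A_{d/2}(x^2) - sum_(0 < a <= d) E^+_a A_(d-a).
   Comparing homogeneous components in
     prod (1 + x) * prod (1 - x) = prod (1 - x^2)
   gives the same recursion for E_d. *)

From HB Require Import structures.
Require Import Defs.
From mathcomp Require Import all_boot all_order all_algebra finmap.
From mathcomp Require Import monalg.
From mathcomp Require Import boolp classical_sets functions cardinality fsbigop.

Set Implicit Arguments.
Unset Strict Implicit.
Unset Printing Implicit Defensive.

Import Order.TTheory GRing.Theory Num.Theory.
Local Open Scope classical_set_scope.
Local Open Scope ring_scope.

Local Arguments expcmn : simpl never.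

(** * Powers and roots of monomials *)

Lemma cmX (a : monom) r v : expcmn a r v = (a v * r)%N.
Proof.
(* [expcmn] iterates without a trailing unit: exponent 1 gives [a], not [a * 1], so [n = 0] needs
   its own case. *)
have expS (n : nat) : expcmn a n.+1 = (a * expcmn a n)%M.
  by case: n => [|n] //; rewrite mulm1.
by elim: r => [|r IHr]; rewrite ?expS ?cmM ?IHr ?mulnS // muln0 cm1.
Qed.

(** Exponents are rounded down, so this is a true [r]-th root only when [m] is an [r]-th power. *)
Definition croot (r : nat) (m : monom) : monom :=
  [cmonom m v %/ r | v in finsupp m]%M.

Lemma crootE r m v : croot r m v = (m v %/ r)%N.
Proof.
by rewrite cmE /= fsfun_fun -cmE_neq0; case: eqP => // ->; rewrite div0n.
Qed.

Lemma crootK r : (0 < r)%N -> cancel (fun a : monom => expcmn a r) (croot r).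
Proof. by move=> r0 a; apply/eqP/cmP => v; rewrite crootE cmX mulnK. Qed.

Lemma expcmn_inj r : (0 < r)%N -> injective (fun a : monom => expcmn a r).
Proof. by move=> /crootK/can_inj. Qed.

Lemma expcmnM r (a b : monom) :
  expcmn (a * b)%M r = (expcmn a r * expcmn b r)%M.
Proof. by apply/eqP/cmP => v; rewrite !(cmM, cmX) mulnDl. Qed.

Lemma expcmn_expcmn r s (a : monom) : expcmn (expcmn a r) s = expcmn a (r * s).
Proof. by apply/eqP/cmP => v; rewrite !cmX mulnA. Qed.

(** * Substitution of powers as a ring endomorphism of series *)

Lemma subst_powX r f (a : monom) : (0 < r)%N ->
  subst_pow r f (expcmn a r) = f a.
Proof.
move=> r0; rewrite /subst_pow (_ : [set _ | _] = [set a]) ?fsbig_set1 //.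
by apply/seteqP; split=> b /= => [/(expcmn_inj r0)|->].
Qed.

Lemma subst_pow0 r f (m : monom) :
  (forall a, expcmn a r <> m) -> subst_pow r f m = 0.
Proof. by move=> H; rewrite /subst_pow fsbig1 // => a /H. Qed.

(** The case split behind the coefficient computations for [subst_pow]: [subst_powX] settles the
    first case and [subst_pow0] the second. *)
Variant root_spec r (m : monom) : Prop :=
  | IsPower a of m = expcmn a r
  | NotPower of (forall a : monom, expcmn a r <> m).

Lemma rootP r m : root_spec r m.
Proof.
have [[a]|/forallNP] := pselect (exists a : monom, expcmn a r = m).
  by left with a.
by right.
Qed.

Lemma series_mulrE (f g : series) m :
  (f * g) m = \sum_(p \in [set p : monom * monom | (p.1 * p.2)%M = m])
    (f p.1 * g p.2).
Proof. by []. Qed.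

Lemma series_sumE (I : Type) (s : seq I) (F : I -> series) m :
  (\sum_(i <- s) F i) m = \sum_(i <- s) F i m.
Proof. exact: (big_morph (fun f : series => f m)). Qed.

(** The exponent has the form [r.+1] so that the morphism instances below need no positivity
    hypothesis. *)
Lemma subst_powB r : {morph subst_pow r.+1 : f g / f - g}.
Proof.
move=> f g; apply/funext => m; have [a -> | H] := rootP r.+1 m.
  by rewrite [RHS](_ : _ = subst_pow r.+1 f (expcmn a r.+1)
       - subst_pow r.+1 g (expcmn a r.+1)) // !subst_powX.
rewrite [RHS](_ : _ = subst_pow r.+1 f m - subst_pow r.+1 g m) //.
by rewrite !subst_pow0 ?subrr.
Qed.

Lemma subst_pow_1 r : subst_pow r.+1 1 = 1.
Proof.
have one1 : expcmn (1%M : monom) r.+1 = 1%M.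
  by apply/eqP/cmP => v; rewrite cmX cm1.
apply/funext => m; have [a -> | H] := rootP r.+1 m.
  rewrite subst_powX // /GRing.one /= /series_one -{2}one1.
  by rewrite (inj_eq (@expcmn_inj r.+1 _)).
rewrite subst_pow0 // /GRing.one /= /series_one.
by case: eqP => // m1; case: (H 1%M); rewrite m1.
Qed.

(** A factorisation contributes only if both factors are powers with exponent [r.+1]. Taking roots
    matches these with the factorisations of the root of [m]; if [m] has no root, there are none. *)
Lemma subst_powM r : {morph subst_pow r.+1 : f g / f * g}.
Proof.
move=> f g; apply/funext => m; rewrite series_mulrE.
have [c -> | H] := rootP r.+1 m; last first.
  rewrite subst_pow0 // fsbig1 // => -[a b] /= abm.
  have [a' aE | ?] := rootP r.+1 a; last by rewrite subst_pow0 ?mul0r.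
  have [b' bE | ?] := rootP r.+1 b; last by rewrite mulrC subst_pow0 ?mul0r.
  by case: (H (a' * b')%M); rewrite expcmnM -aE -bE.
pose h (p : monom * monom) := (expcmn p.1 r.+1, expcmn p.2 r.+1).
rewrite -(@fsbig_widen _ _ _ _ (h @` [set p | (p.1 * p.2)%M = c])); first last.
- move=> [a b] /= [abm nab].
  have [a' aE | ?] := rootP r.+1 a; last by rewrite subst_pow0 ?mul0r.
  have [b' bE | ?] := rootP r.+1 b; last by rewrite mulrC subst_pow0 ?mul0r.
  case: nab; exists (a', b'); rewrite /h -?aE -?bE //.
  by apply: (@expcmn_inj r.+1) => //=; rewrite expcmnM -aE -bE.
- by move=> _ [p /= <- <-]; rewrite expcmnM.
rewrite fsbig_image.
  rewrite subst_powX //; apply: eq_fsbigr => p _.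
  by rewrite !subst_powX.
move=> [a b] [a' b'] _ _ [ea eb].
by congr pair; [apply: (@expcmn_inj r.+1 _ _ _ ea) |
  apply: (@expcmn_inj r.+1 _ _ _ eb)].
Qed.

HB.instance Definition _ r := GRing.isZmodMorphism.Build series series
  (subst_pow r.+1) (subst_powB r).
HB.instance Definition _ r := GRing.isMonoidMorphism.Build series series
  (subst_pow r.+1) (conj (subst_pow_1 r) (subst_powM r)).

Lemma subst_pow_comp r s f : (0 < r)%N -> (0 < s)%N ->
  subst_pow r (subst_pow s f) = subst_pow (s * r) f.
Proof.
move=> r0 s0; apply/funext => m; have [a -> | H] := rootP r m; last first.
  rewrite !subst_pow0 // => a; rewrite -expcmn_expcmn; exact: H.
rewrite subst_powX //; have [b -> | H] := rootP s a.
  by rewrite expcmn_expcmn !subst_powX // muln_gt0 s0.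
rewrite !subst_pow0 // => b; rewrite -expcmn_expcmn.
by move/(expcmn_inj r0); apply: H.
Qed.

Lemma subst_pow_id f : subst_pow 1 f = f.
Proof. by apply/funext => m; rewrite -[m in LHS]/(expcmn m 1) subst_powX. Qed.

(** * Degrees and homogeneous components *)

Lemma degE (m : monom) (D : {fset indet}) : (finsupp m `<=` D)%fset ->
  deg m = (\sum_(v <- D) m v * val v.1)%N.
Proof.
move=> sD; rewrite /deg (big_fset_incl _ sD) //= => v _.
by rewrite -cmE_eq0 => /eqP ->.
Qed.

Lemma deg1 : deg 1%M = 0%N.
Proof. by rewrite /deg big1 // => v _; rewrite cm1. Qed.

Lemma degM (a b : monom) : deg (a * b)%M = (deg a + deg b)%N.
Proof.
pose D := (finsupp a `|` finsupp b `|` finsupp (a * b)%M)%fset.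
have [aD bD abD] : [/\ finsupp a `<=` D, finsupp b `<=` D &
    finsupp (a * b)%M `<=` D]%fset.
  by split; apply/fsubsetP => v; rewrite !inE => ->; rewrite ?orbT.
rewrite !(@degE _ D) //.
by rewrite -big_split /=; apply: eq_bigr => v _; rewrite cmM mulnDl.
Qed.

Lemma degX (a : monom) r : deg (expcmn a r) = (deg a * r)%N.
Proof.
pose D := (finsupp a `|` finsupp (expcmn a r))%fset.
rewrite !(@degE _ D) ?fsubsetUr ?fsubsetUl // big_distrl /=.
by apply: eq_bigr => v _; rewrite cmX mulnAC.
Qed.

Definition homog (d : nat) (f : series) : series := fun m =>
  if deg m == d then f m else 0.

(** Degree is additive, so a factorisation of a monomial of degree [d] is counted for exactly one
    [a], the degree of its first factor; in any other degree no [a] fits. *)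
Lemma homogM d f g :
  homog d (f * g) = \sum_(a < d.+1) homog a f * homog (d - a) g.
Proof.
apply/funext => m; rewrite series_sumE.
under eq_bigr do
  rewrite series_mulrE (fsbig_finite _ _ (finite_factorisations m)).
rewrite exchange_big /= /homog; case: eqP => md.
  rewrite series_mulrE (fsbig_finite _ _ (finite_factorisations m)).
  apply: eq_big_seq => -[a b]; rewrite in_fset_set;
    last exact: finite_factorisations.
  move=> /set_mem /= abm.
  have ad : (deg a < d.+1)%N by rewrite ltnS -md -abm degM leq_addr.
  rewrite (bigD1 (Ordinal ad)) //= eqxx (_ : d - deg a = deg b)%N; last first.
    by rewrite -md -abm degM addKn.
  rewrite eqxx big1 ?addr0 //.
  by move=> i; rewrite -val_eqE /= eq_sym => /negPf ->; rewrite mul0r.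
rewrite big_seq big1 // => -[a b]; rewrite in_fset_set;
    last exact: finite_factorisations.
move=> /set_mem /= abm; rewrite big1 // => i _.
case: eqP => [ai|_]; last by rewrite mul0r.
case: eqP => [bi|_]; last by rewrite mulr0.
by case: md; rewrite -abm degM ai bi subnKC // -ltnS.
Qed.

Lemma homog_subst_pow r d f : (0 < r)%N ->
  homog d (subst_pow r f) =
  if (r %| d)%N then subst_pow r (homog (d %/ r) f) else 0.
Proof.
move=> r0; apply/funext => m; have [a -> | H] := rootP r m; last first.
  by rewrite /homog subst_pow0 // if_same; case: ifP; rewrite // subst_pow0.
rewrite [LHS]/homog degX subst_powX //; case: (boolP (r %| d)%N) => rd.
  rewrite subst_powX // /homog -[in LHS](divnK rd) eqn_pmul2r //.
by case: eqP rd => // <-; rewrite dvdn_mull.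
Qed.

(** * Square-free sums and the recursion for [E] *)

Definition sqf_sum : series := fun m => if squarefree m then 1 else 0.
Definition signed_sqf_sum : series := fun m =>
  if squarefree m then (-1) ^+ #|` finsupp m| else 0.

Lemma squarefreeP (m : monom) : reflect (forall v, m v <= 1)%N (squarefree m).
Proof.
apply: (iffP allP) => H v; last by move=> _; exact: H.
by have [/H //|] := boolP (v \in finsupp m); rewrite -cmE_eq0 => /eqP ->.
Qed.

Definition with_exp (a : monom) (v : indet) (k : nat) : monom :=
  mkcmonom [fsfun cmonom_val a with v |-> k].

Lemma with_expE a v k w : with_exp a v k w = if w == v then k else a w.
Proof. by rewrite cmE /= fsfun_withE. Qed.

(** The product of the pair is unchanged; this becomes the sign-reversing involution on
    factorisations. *)
Definition swap_exp v (p : monom * monom) :=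
  (with_exp p.1 v (p.2 v), with_exp p.2 v (p.1 v)).

Lemma swap_expK v : involutive (swap_exp v).
Proof.
by move=> [a b]; congr pair; apply/eqP/cmP => w;
  rewrite !with_expE eqxx; case: eqP => // ->.
Qed.

Lemma mul_swap_exp v (p : monom * monom) :
  ((swap_exp v p).1 * (swap_exp v p).2 = p.1 * p.2)%M.
Proof.
apply/eqP/cmP => w; rewrite !cmM !with_expE.
by case: eqP => // ->; rewrite addnC.
Qed.

(** Only the conjunction is invariant: an exponent above 1 at [v] moves to the other factor. *)
Lemma squarefree_swap_exp v (p : monom * monom) :
  squarefree (swap_exp v p).1 && squarefree (swap_exp v p).2 =
  squarefree p.1 && squarefree p.2.
Proof.
have imp q : squarefree q.1 && squarefree q.2 ->
    squarefree (swap_exp v q).1 && squarefree (swap_exp v q).2.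
  case/andP => /squarefreeP q1 /squarefreeP q2; apply/andP; split;
  by apply/squarefreeP => w; rewrite with_expE; case: eqP.
by apply/idP/idP => /imp //; rewrite swap_expK.
Qed.

(** Exactly one factor contains [v], so the swap adds [v] to the support of the second factor or
    removes it, changing its size by one. *)
Lemma signr_finsupp_swap_exp v (p : monom * monom) : (p.1 v + p.2 v)%N = 1%N ->
  (-1) ^+ #|` finsupp (swap_exp v p).2| = - (-1) ^+ #|` finsupp p.2| :> rat.
Proof.
case: p => a b /= ab1.
have -> : finsupp (with_exp b v (a v)) =
    if a v == 0%N then (finsupp b `\ v)%fset else (v |` finsupp b)%fset.
  apply/fsetP => w; rewrite -cmE_neq0 with_expE.
  have [->|nwv] := eqVneq w v; case: ifP => a0;
  by rewrite ?a0 ?inE ?eqxx -?cmE_neq0 ?(negPf nwv) ?nwv.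
case: ifP => [/eqP a0|].
  rewrite [in RHS](cardfsD1 v) -cmE_neq0; move: ab1; rewrite a0 add0n => -> /=.
  by rewrite exprS mulN1r opprK.
move: ab1; case: (a v) => // -[|n] //; rewrite add1n => -[b0] _.
by rewrite cardfsU1 -cmE_eq0 b0 exprS mulN1r.
Qed.

(* Here sqf_sum and signed_sqf_sum are prod (1 + x) and prod (1 - x). At a
   square only one factorisation survives; elsewhere, swapping the exponents at
   a variable of odd exponent is a sign-reversing involution. *)
Lemma sqf_sumM : sqf_sum * signed_sqf_sum = subst_pow 2 signed_sqf_sum.
Proof.
apply/funext => m; rewrite series_mulrE; have [c -> | H] := rootP 2 m.
  rewrite subst_powX // -(@fsbig_widen _ _ _ _ [set (c, c)]).
  - rewrite fsbig_set1 /= /sqf_sum /signed_sqf_sum.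
    by case: ifP; rewrite (mul1r, mul0r).
  - by move=> _ ->.
  move=> [a b] /= [abc nab]; rewrite /sqf_sum /signed_sqf_sum.
  case: squarefreeP => [a1|]; last by rewrite mul0r.
  case: squarefreeP => [b1|]; last by rewrite mulr0.
  suff E v : a v = c v /\ b v = c v.
    by case: nab; congr pair; apply/eqP/cmP => v; case: (E v).
  (* Two exponents at most 1 with the even sum [2 * c v] must both equal [c v]. *)
  have: (a * b)%M v = expcmn c 2 v by rewrite abc.
  move: (a1 v) (b1 v); rewrite cmM cmX muln2.
  by case: (a v) => [|[|]]; case: (b v) => [|[|]] // _ _; case: (c v) => [|[|]].
rewrite subst_pow0 //.
(* If all exponents were even, [croot 2 m] would be a square root of [m]. *)
have [v odd_mv] : exists v, odd (m v).
  apply: contrapT => /forallNP mv; case: (H (croot 2 m)).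
  apply/eqP/cmP => v; rewrite cmX crootE muln2 divn2.
  by rewrite -[RHS](odd_double_half (m v)) (negPf (introN idP (mv v))).
set S := \sum_(p \in _) _; suff SN : S = - S.
  have: S *+ 2 == 0 by rewrite mulr2n {2}SN subrr.
  by rewrite mulrn_eq0 => /eqP.
rewrite {1}/S (@reindex_fsbig _ _ _ _ _ (swap_exp v)
  [set p | (p.1 * p.2)%M = m]); last first.
  split=> [p /= <-|p q _ _ /(can_inj (swap_expK v)) //|p /= pm].
    exact: mul_swap_exp.
  by exists (swap_exp v p); rewrite ?swap_expK //= -pm mul_swap_exp.
rewrite {}/S !(fsbig_finite _ _ (finite_factorisations m)) -sumrN.
apply: eq_big_seq => p; rewrite in_fset_set; last exact: finite_factorisations.
move=> /set_mem /= pm; rewrite /sqf_sum /signed_sqf_sum.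
(* If some factor is not square-free, the same holds after the swap, and both terms vanish. *)
have := squarefree_swap_exp v p.
case: (boolP (squarefree p.1)) => p1; last first.
  by rewrite mul0r oppr0; case: ifP => [_ /= ->|]; rewrite (mulr0, mul0r).
case: (boolP (squarefree p.2)) => p2; last first.
  by rewrite mulr0 oppr0; case: ifP => [_ /= ->|]; rewrite (mulr0, mul0r).
case/andP => -> ->; rewrite !mul1r signr_finsupp_swap_exp //.
(* An odd sum of two exponents at most 1 equals 1, as the sign change requires. *)
move: odd_mv (squarefreeP _ p1 v) (squarefreeP _ p2 v); rewrite -pm cmM.
by case: (p.1 v) => [|[|]]; case: (p.2 v) => [|[|]].
Qed.

(** This is the degree [d] component of [sqf_sumM]. *)
Lemma Eplus_E d :
  \sum_(a < d.+1) Eplus a * E (d - a) =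
  if (2 %| d)%N then subst_pow 2 (E (d %/ 2)) else 0.
Proof.
have EE n : E n = homog n signed_sqf_sum.
  apply/funext => m; rewrite /E /homog /signed_sqf_sum.
  by case: (squarefree m); case: eqP.
have EpE n : Eplus n = homog n sqf_sum.
  apply/funext => m; rewrite /Eplus /homog /sqf_sum.
  by case: (squarefree m); case: eqP.
under eq_bigr do rewrite EE EpE.
by rewrite -homogM sqf_sumM homog_subst_pow // EE.
Qed.

Lemma squarefree1 : squarefree 1%M.
Proof. by apply/squarefreeP => v; rewrite cm1. Qed.

Lemma deg_eq0 m : (deg m == 0%N) = (m == 1%M).
Proof.
apply/idP/eqP => [|->]; last by rewrite deg1.
rewrite /deg sum_nat_seq_eq0 => /allP m0; apply/eqP/cmP => v; rewrite cm1.
apply/eqP; have [/m0|] := boolP (v \in finsupp m); last by rewrite cmE_eq0.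
by rewrite /= muln_eq0 [val _ == _]eqn0Ngt (valP v.1) orbF.
Qed.

Lemma Eplus0 : Eplus 0 = 1.
Proof.
apply/funext => m; rewrite /Eplus /GRing.one /= /series_one deg_eq0.
by case: eqP => [->|_]; rewrite ?squarefree1 ?andbF.
Qed.

Lemma E0 : E 0 = 1.
Proof.
apply/funext => m; rewrite /E /GRing.one /= /series_one deg_eq0.
by case: eqP => [->|_]; rewrite ?squarefree1 ?andbF // mdom1.
Qed.

(** Since [Eplus 0 = 1], the term [a = 0] of [Eplus_E] is [E d.+1] itself; the remaining indices are
    shifted by one. *)
Lemma E_rec d : E d.+1 =
  (if (2 %| d.+1)%N then subst_pow 2 (E (d.+1 %/ 2)) else 0) -
  \sum_(a < d.+1) Eplus a.+1 * E (d - a).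
Proof.
by rewrite -Eplus_E big_ord_recl /= Eplus0 mul1r subn0 addrK.
Qed.

(** * Prepending a part and doubling multiplicities *)

Definition succp (n : nat) : posnat := exist _ n.+1 isT.

Lemma double_posnat_subproof (r : posnat) : (0 < (val r).*2)%N.
Proof. by rewrite double_gt0 (valP r). Qed.

Definition dblp (r : posnat) : posnat :=
  exist _ (val r).*2 (double_posnat_subproof r).

(** Meant for even arguments only. Taking the predecessor inside [succp] keeps the value positive;
    the junk value at 1 is 1. *)
Definition halfp (r : posnat) : posnat := succp (val r)./2.-1.

Lemma dblpK : cancel dblp halfp.
Proof. by move=> r; apply: val_inj; rewrite /= doubleK prednK // (valP r). Qed.

Lemma halfpK r : ~~ odd (val r) -> dblp (halfp r) = r.
Proof.
move=> /even_halfK rK; apply: val_inj; rewrite /= prednK //.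
by rewrite -double_gt0 rK (valP r).
Qed.

(** Allowing any [S] above the support lets polycompositions with different supports be compared
    over one index set; by [permP], such counts decide [perm_eq]. *)
Lemma count_blocks p (delta : polycomp) (S : {fset posnat}) :
  (finsupp delta `<=` S)%fset ->
  count p (blocks delta) =
  (\sum_(r <- S) count (fun d => p (d, r)) (delta r))%N.
Proof.
move=> sS; rewrite /blocks count_flatten sumnE -map_comp big_map.
under eq_bigr do rewrite /= count_map.
by apply: big_fset_incl => // r _; rewrite memNfinsupp => /eqP ->.
Qed.

Lemma plengthE delta : plength delta = size (blocks delta).
Proof.
by rewrite -count_predT (@count_blocks _ _ (finsupp delta)) //.
Qed.

Lemma weightE delta :
  weight delta = (\sum_(b <- blocks delta) val b.2 * val b.1)%N.
Proof.
rewrite /blocks big_allpairs_dep; apply: eq_bigr => r _.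
by rewrite big_distrr.
Qed.

(** [succp 0] is the multiplicity 1, so [a] becomes the first part of the component of multiplicity
    1. *)
Definition pcons (a : posnat) (delta : polycomp) : polycomp :=
  [fsfun delta with succp 0 |-> a :: delta (succp 0)].

Lemma pconsE a delta r :
  pcons a delta r = if r == succp 0 then a :: delta (succp 0) else delta r.
Proof. exact: fsfun_withE. Qed.

(** Equality up to order suffices, because weight, length and [Eplus_poly] depend only on the
    multiset of blocks. *)
Lemma blocks_pcons a delta :
  perm_eq (blocks (pcons a delta)) ((a, succp 0) :: blocks delta).
Proof.
pose S := (succp 0 |` (finsupp delta `|` finsupp (pcons a delta)))%fset.
have oneS : succp 0 \in S by rewrite !inE eqxx.
have [s1 s2] : (finsupp delta `<=` S)%fset /\
    (finsupp (pcons a delta) `<=` S)%fset.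
  by split; apply/fsubsetP => r; rewrite !in_fsetE => ->; rewrite ?orbT.
apply/permP => p; rewrite /= (count_blocks p s1) (count_blocks p s2).
rewrite !(big_fsetD1 _ oneS) /= pconsE eqxx /= addnA; congr (_ + _)%N.
by apply: eq_big_seq => r; rewrite !inE pconsE => /andP[/negPf ->].
Qed.

(** A finitely supported function needs an explicit finite domain; on this one [halfp] inverts
    [dblp]. *)
Definition pdouble (delta : polycomp) : polycomp :=
  [fsfun r in [fset dblp r | r in finsupp delta]%fset =>
    delta (halfp r) | [::]].

Lemma pdoubleE delta r : pdouble delta (dblp r) = delta r.
Proof.
rewrite /pdouble fsfun_fun mem_imfset /=; last exact: can_inj dblpK.
by rewrite dblpK; case: finsuppP.
Qed.

Lemma pdouble_odd delta r : odd (val r) -> pdouble delta r = [::].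
Proof.
move=> r_odd; rewrite /pdouble fsfun_fun ifF //; apply/negP => /imfsetP[s _ rE].
by move: r_odd; rewrite rE /= odd_double.
Qed.

Lemma blocks_pdouble delta :
  perm_eq (blocks (pdouble delta)) [seq (b.1, dblp b.2) | b <- blocks delta].
Proof.
apply/permP => p; rewrite count_map (@count_blocks _ _ (finsupp delta)) //.
rewrite (@count_blocks _ _ [fset dblp r | r in finsupp delta]%fset).
  rewrite big_imfset /=; last by move=> r s _ _; apply: (can_inj dblpK).
  by apply: eq_bigr => r _; rewrite pdoubleE.
exact: finsupp_sub.
Qed.

Lemma weight_pcons a delta : weight (pcons a delta) = (val a + weight delta)%N.
Proof.
by rewrite !weightE (perm_big _ (blocks_pcons a delta)) big_cons mul1n.
Qed.

Lemma plength_pcons a delta : plength (pcons a delta) = (plength delta).+1.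
Proof. by rewrite !plengthE (perm_size (blocks_pcons a delta)). Qed.

Lemma Eplus_poly_pcons a delta :
  Eplus_poly (pcons a delta) = Eplus (val a) * Eplus_poly delta.
Proof.
rewrite /Eplus_poly (perm_big _ (blocks_pcons a delta)) big_cons.
by rewrite {1}/Eplus_block subst_pow_id.
Qed.

Lemma weight_pdouble delta : weight (pdouble delta) = (weight delta).*2.
Proof.
rewrite !weightE (perm_big _ (blocks_pdouble delta)) big_map -muln2 big_distrl.
by apply: eq_bigr => b _ /=; rewrite -muln2 mulnAC.
Qed.

Lemma plength_pdouble delta : plength (pdouble delta) = plength delta.
Proof. by rewrite !plengthE (perm_size (blocks_pdouble delta)) size_map. Qed.

(** Substituting squares is a ring morphism, and composing it with exponent [r] gives exponent
    [2 * r], so the identity holds block by block. *)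
Lemma Eplus_poly_pdouble delta :
  Eplus_poly (pdouble delta) = subst_pow 2 (Eplus_poly delta).
Proof.
rewrite /Eplus_poly (perm_big _ (blocks_pdouble delta)) big_map rmorph_prod.
apply: eq_bigr => b _.
by rewrite /Eplus_block /= subst_pow_comp ?(valP b.2) // muln2.
Qed.

(** * Dyadic polycompositions under the two operations *)

Definition dyadic (delta : polycomp) :=
  forall i, delta i != [::] -> exists k : nat, val i = (2 ^ k)%N.

Lemma dyadic_pcons a delta : dyadic (pcons a delta) <-> dyadic delta.
Proof.
split=> H i; have := H i; rewrite pconsE.
  by have [->|_] := eqVneq i (succp 0) => // _ _; exists 0%N.
by have [->|_] := eqVneq i (succp 0) => // _ _; exists 0%N.
Qed.

Lemma dyadic_pdouble delta : dyadic (pdouble delta) <-> dyadic delta.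
Proof.
split=> H i; last first.
  have [iodd|ieven] := boolP (odd (val i)); first by rewrite pdouble_odd.
  rewrite -(halfpK ieven) pdoubleE => /H[k kE].
  by exists k.+1; rewrite /= expnS mul2n -kE.
(* A doubled multiplicity is even, which excludes [2 ^ 0]; otherwise one factor 2 cancels. *)
rewrite -pdoubleE => /H[[|k]] /=.
  by move/(congr1 odd); rewrite odd_double.
by rewrite expnS mul2n => /double_inj; exists k.
Qed.

Lemma pcons_inj a : injective (pcons a).
Proof.
move=> delta1 delta2 /fsfunP E; apply/fsfunP => r.
by have := E r; rewrite !pconsE; case: eqP => // -> [].
Qed.

Lemma pdouble_inj : injective pdouble.
Proof.
move=> delta1 delta2 /fsfunP E; apply/fsfunP => r.
by rewrite -[LHS]pdoubleE E pdoubleE.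
Qed.

Lemma pcons_surj a (delta : polycomp) : ohead (delta (succp 0)) = Some a ->
  exists delta', delta = pcons a delta'.
Proof.
move=> ha; exists [fsfun delta with succp 0 |-> behead (delta (succp 0))].
apply/fsfunP => r; rewrite pconsE !fsfun_withE eqxx; case: eqP => // ->.
by move: ha; case: (delta _) => //= b s [->].
Qed.

(** The only odd power of 2 is 1, so once the component of multiplicity 1 is empty, all
    multiplicities present are even and can be halved. *)
Lemma pdouble_surj (delta : polycomp) : delta (succp 0) = [::] -> dyadic delta ->
  exists delta', delta = pdouble delta'.
Proof.
move=> d1 dd.
exists [fsfun r in [fset halfp r | r in finsupp delta]%fset =>
  delta (dblp r) | [::]].
apply/fsfunP => r; have [rodd|reven] := boolP (odd (val r)).
  rewrite pdouble_odd //; apply/eqP/negPn/negP => r0.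
  have [[|k] kE] := dd _ r0; last by move: rodd; rewrite kE oddX.
  by move: r0; rewrite (_ : r = succp 0) ?d1 //; apply: val_inj.
rewrite -[in RHS](halfpK reven) pdoubleE fsfun_fun halfpK //.
case: ifPn => // /imfsetP nr; apply/eqP/negPn/negP; rewrite -mem_finsupp => rS.
by case: nr; exists r.
Qed.

(** * The recursion for the signed sum over dyadic polycompositions *)

Definition signed_Eplus (delta : polycomp) : series :=
  (-1) ^+ plength delta * Eplus_poly delta.

Lemma PCom_dyadE n delta :
  PCom_dyad n delta <-> weight delta = n /\ dyadic delta.
Proof. by []. Qed.

(** [pdouble] is a bijection onto the index set. It keeps the length, hence the sign, and doubles
    the weight, so the set is empty for odd [d]. *)
Lemma sum_PCom_dyad_double d :
  \sum_(delta \in PCom_dyad d `&` [set delta : polycomp | delta (succp 0) = [::]])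
    signed_Eplus delta =
  if (2 %| d)%N then
    subst_pow 2 (\sum_(delta \in PCom_dyad (d %/ 2)) signed_Eplus delta)
  else 0.
Proof.
case: ifPn => [d_even | d_odd]; last first.
  rewrite fsbig1 // => delta [/PCom_dyadE[w dd] /= d1].
  have [delta' dE] := pdouble_surj d1 dd.
  by move: d_odd; rewrite -w dE weight_pdouble dvdn2 odd_double.
rewrite (_ : _ `&` _ = pdouble @` PCom_dyad (d %/ 2)); last first.
  apply/seteqP; split=> [delta [/PCom_dyadE[w dd] /= d1]|
      _ [delta /PCom_dyadE[w dd] <-]].
    have [delta' dE] := pdouble_surj d1 dd; exists delta' => //.
    apply/PCom_dyadE; rewrite -dyadic_pdouble -dE; split=> //.
    by rewrite -w dE weight_pdouble divn2 doubleK.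
  split=> /=; last exact: pdouble_odd.
  apply/PCom_dyadE; rewrite dyadic_pdouble; split=> //.
  by rewrite weight_pdouble w -muln2 divnK.
rewrite fsbig_image; last by move=> ? ? _ _; apply: pdouble_inj.
rewrite !(fsbig_finite _ _ (finite_PCom_dyad _)) rmorph_sum.
apply: eq_bigr => delta _; rewrite /signed_Eplus plength_pdouble.
by rewrite Eplus_poly_pdouble rmorphM rmorph_sign.
Qed.

(** [pcons (succp a)] is a bijection onto the index set. The prepended part [a + 1] contributes the
    factor [Eplus a.+1], and the extra block flips the sign. *)
Lemma sum_PCom_dyad_cons d (a : 'I_d.+1) :
  \sum_(delta \in PCom_dyad d.+1 `&`
      [set delta : polycomp | ohead (delta (succp 0)) = Some (succp a)])
    signed_Eplus delta =
  - (Eplus a.+1 * \sum_(delta \in PCom_dyad (d - a)) signed_Eplus delta).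
Proof.
have ad : (a <= d)%N by rewrite -ltnS.
rewrite (_ : _ `&` _ = pcons (succp a) @` PCom_dyad (d - a)); last first.
  apply/seteqP; split=> [delta [/PCom_dyadE[w dd] /= d1]|
      _ [delta /PCom_dyadE[w dd] <-]].
    have [delta' dE] := pcons_surj d1; exists delta' => //.
    apply/PCom_dyadE; rewrite -(dyadic_pcons (succp a)) -dE; split=> //.
    move: w; rewrite dE weight_pcons /= addSn => -[w].
    by apply/eqP; rewrite -(eqn_add2l a) w subnKC.
  split=> /=; last by rewrite pconsE.
  apply/PCom_dyadE; rewrite dyadic_pcons; split=> //.
  by rewrite weight_pcons w /= addSn subnKC.
rewrite fsbig_image; last by move=> ? ? _ _; apply: pcons_inj.
rewrite !(fsbig_finite _ _ (finite_PCom_dyad _)) mulr_sumr -sumrN.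
apply: eq_bigr => delta _; rewrite /signed_Eplus plength_pcons.
by rewrite Eplus_poly_pcons exprS mulN1r mulNr mulrCA.
Qed.

Lemma PCom_dyad_rec d :
  \sum_(delta \in PCom_dyad d.+1) signed_Eplus delta =
  (if (2 %| d.+1)%N then
    subst_pow 2 (\sum_(delta \in PCom_dyad (d.+1 %/ 2)) signed_Eplus delta)
   else 0) -
  \sum_(a < d.+1)
    Eplus a.+1 * \sum_(delta \in PCom_dyad (d - a)) signed_Eplus delta.
Proof.
rewrite (@fsbigID _ _ _ _ [set delta : polycomp | delta (succp 0) = [::]]); last first.
  exact: finite_PCom_dyad.
rewrite sum_PCom_dyad_double; congr (_ + _); rewrite -sumrN.
(* Turning the condition on the first part into an indicator puts all inner sums over one index set,
   so the two summations can be exchanged. *)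
under [RHS]eq_bigr do rewrite -sum_PCom_dyad_cons fsbig_mkcondr
  (fsbig_finite _ _ (finite_PCom_dyad _)).
rewrite exchange_big -(fsbig_finite _ _ (finite_PCom_dyad _)).
rewrite setIC fsbig_mkcondl.
apply: eq_fsbigr => delta /set_mem /PCom_dyadE[w dd] /=.
case: ifPn => [/set_mem /= d1 | /negP d1]; last first.
  rewrite big1 // => a _; rewrite ifF //; apply/negP => /set_mem /= da.
  by apply: d1; apply/mem_set => /= d0; rewrite d0 in da.
have [b bE] : exists b, ohead (delta (succp 0)) = Some b.
  by move: d1; case: (delta _) => // b s _; exists b.
have [delta' dE] := pcons_surj bE.
(* The first part [b] is at most the total weight [d.+1], so [b - 1] is the one index [a] that
   counts [delta]. *)
have bd : ((val b).-1 < d.+1)%N.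
  by rewrite -w dE weight_pcons prednK ?(valP b) // leq_addr.
have bS : b = succp (Ordinal bd).
  by apply: val_inj; rewrite /= prednK // (valP b).
rewrite (bigD1 (Ordinal bd)) //= ifT; last by apply/mem_set; rewrite /= bE -bS.
rewrite big1 ?addr0 // => a nab; rewrite ifF //; apply/negP => /set_mem /=.
rewrite bE bS => -[ba]; case/eqP: nab; exact/val_inj.
Qed.

(** Any block adds a product of two positive integers to the weight, so weight 0 leaves no
    blocks. *)
Lemma PCom_dyad0 : PCom_dyad 0 = [set [fsfun with [::]] : polycomp].
Proof.
apply/seteqP; split=> [delta /PCom_dyadE[w _] | _ ->].
  apply/fsfunP => r; rewrite fsfun0E; apply: fsfun_dflt; apply/negP => rS.
  move: w; rewrite /weight (big_fsetD1 r) //=; move: rS; rewrite mem_finsupp.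
  case: (delta r) => // d s _; rewrite big_cons.
  by case: r d => [[|r]] // ? [[|d]].
by split=> [|i]; rewrite ?fsfun0E // /PCom /mkset /weight finsupp0 big_nil.
Qed.

Theorem proposition30 (d : nat) :
  E d = \sum_(delta \in PCom_dyad d) (-1) ^+ plength delta * Eplus_poly delta.
Proof.
(* Strong induction is needed: the recursion reaches back to half of [d.+1] and to every [d - a]. *)
elim/ltn_ind: d => -[|d] IHd.
  rewrite PCom_dyad0 fsbig_set1 E0 plengthE /Eplus_poly /blocks.
  by rewrite finsupp0 big_nil mulr1.
rewrite E_rec [RHS]PCom_dyad_rec; congr (_ - _).
  by case: ifP => // _; rewrite IHd // ltn_Pdiv.
by apply: eq_bigr => a _; rewrite IHd // ltnS leq_subr.
Qed.
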